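(* $\mathbf{Top}_{\mathsf{AlgS}}=\mathbf{Top}_{\mathsf{ConS}}=\mathbf{Top}_{\mathbb D'}$, where $\mathsf{AlgS}$ is the class of all algebraic spaces, $\mathsf{ConS}$ the class of all continuous spaces, and $\mathbb D'$ the class of all strong one-point convergence spaces.
   Context: All spaces are $T_0$; $\mathbf{Top}$ is the category of $T_0$ spaces and continuous maps. For a class $\mathbb C$ of $T_0$ spaces, a subset $U$ of a space $X$ is $\mathbb C$-open if $k^{-1}(U)$ is open in $C$ for every $C\in\mathbb C$ and every continuous map $k:C\to X$; $X$ is $\mathbb C$-generated if every $\mathbb C$-open subset is open; $\mathbf{Top}_{\mathbb C}$ is the full subcategory of $\mathbf{Top}$ of $\mathbb C$-generated spaces. In a space $X$, with specialization order $x\sqsubseteq y$ iff $x\in\overline{\{y\}}$, write $\uparrow y=\{z\in X:y\sqsubseteq z\}$. $X$ is a continuous space ($c$-space) if for every open $U$ and $x\in U$ there is $y\in U$ with $x\in\mathrm{int}(\uparrow y)$. $X$ is algebraic if for every open $U$ and $x\in U$ there is $k\in X$ with $x\in\mathrm{int}(\uparrow k)=\uparrow k\subseteq U$. Strong one-point convergence spaces are the spaces $(D\cup\{\infty\},\gamma_D)$, where $D$ is a (non-empty) directed poset with no largest element, $\infty\notin D$, and $\gamma_D$ is the topology with subbase all sets $\{y\in D:x\le y\}\cup\{\infty\}$, $x\in D$. *)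

(* Defs.v *)
From HB Require Import structures.
From mathcomp Require Import all_boot all_order all_classical topology.

Set Implicit Arguments.
Unset Strict Implicit.
Unset Printing Implicit Defensive.

Import Order.TTheory.

Local Open Scope classical_set_scope.
Local Open Scope order_scope.

Definition space_class := topologicalType -> Prop.

Section GeneratedSpaces.
Variables (CC : space_class) (X : topologicalType).

Definition class_open (U : set X) : Prop :=
  forall (C : topologicalType) (k : C -> X),
    CC C -> continuous k -> open (k @^-1` U).

Definition class_generated : Prop :=
  forall U : set X, class_open U -> open U.

End GeneratedSpaces.

(* A full subcategory of the category of T0 spaces is determined by its class of
   objects and is represented by it; equality of full subcategories is then
   equality of these classes. *)
Definition Top_gen (CC : space_class) : space_class :=
  fun X => kolmogorov_space X /\ class_generated CC X.

Definition spec_le (X : topologicalType) (x y : X) : Prop :=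
  closure [set y] x.

Definition up_set (X : topologicalType) (y : X) : set X :=
  [set z | spec_le y z].

Definition ConS : space_class := fun X =>
  kolmogorov_space X /\
  forall (U : set X) (x : X), open U -> U x ->
    exists2 y, U y & (up_set y)° x.

Definition AlgS : space_class := fun X =>
  kolmogorov_space X /\
  forall (U : set X) (x : X), open U -> U x ->
    exists k : X, [/\ (up_set k)° x, (up_set k)° = up_set k & up_set k `<=` U].

Definition directed_poset (d : Order.disp_t) (D : porderType d) : Prop :=
  inhabited D /\
  forall x y : D, exists z : D, x <= z /\ y <= z.

Definition has_largest (d : Order.disp_t) (D : porderType d) : Prop :=
  exists m : D, forall x : D, x <= m.

(* [None] is the added point; [Some] embeds D. *)
Definition one_point_conv (d : Order.disp_t) (D : porderType d) : Type :=
  option D.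

Section OnePointConvTopology.
Variables (d : Order.disp_t) (D : porderType d).

Definition gamma_subbase : set (set (one_point_conv D)) :=
  [set B | exists x : D, B = [set Some y | y in [set y : D | x <= y]]
                             `|` [set None]].

HB.instance Definition _ := Choice.on (one_point_conv D).

(* The index type of the subbase is the type of subsets itself. *)
HB.instance Definition _ :=
  @isSubBaseTopological.Build (one_point_conv D)
    (set (one_point_conv D)) gamma_subbase id.

End OnePointConvTopology.

Definition homeomorphic (X Y : topologicalType) : Prop :=
  exists (f : X -> Y) (g : Y -> X),
    [/\ continuous f, continuous g, cancel f g & cancel g f].

(* [option D] models D with any one point outside D adjoined, hence a space
   belongs to the class when it is homeomorphic to some [one_point_conv D]. *)
Definition StrongOnePointConv : space_class := fun X =>
  exists (d : Order.disp_t) (D : porderType d),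
    [/\ directed_poset D, ~ has_largest D & homeomorphic (one_point_conv D) X].

(* Main.v *)
Require Import Defs.
From mathcomp Require Import finmap.
From mathcomp Require Import all_boot all_order all_classical topology.
From HB Require Import structures.

Set Implicit Arguments.
Unset Strict Implicit.
Unset Printing Implicit Defensive.

Import Order.TTheory.

Local Open Scope classical_set_scope.
Local Open Scope order_scope.

(** If every space of one class is generated by a second class, then every space
    generated by the first is generated by the second
    ([class_generated_trans]); so three such comparisons, arranged in a circle,
    suffice.

    Algebraic spaces are continuous: a point [k] with open up-set inside [U]
    itself lies in [U].

    Strong one-point convergence spaces are algebraic.  For directed [D] the
    opens of [one_point_conv D] are exactly the Scott-like sets: upper sets,
    containing the added point as soon as they are nonempty, and meeting [D]
    as soon as they contain the added point ([open_one_point_conv]).  Hence the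
    up-set of each point of [D] is open, and these up-sets form a base.

    Continuous spaces are generated by strong one-point convergence spaces;
    this is the substantial step.  Let a subset [A] of [X], directed for the
    specialization order, converge to one of its upper bounds [x].  Sending [A]
    to itself and the added point to [x] tests any [U] against this
    convergence.  The absence of a largest element costs nothing: replace [A]
    by its product with [nat].  A class-open [U] therefore is upper along
    [A], and meets [A] if it contains [x]
    ([directed_limit_StrongOnePointConv_open]).  The set [{u, v}] with [u]
    below [v] shows that [U] is an upper set.  In a continuous space the points
    [y] with [x] interior to the up-set of [y] form such a set converging
    to [x], so if [U] contains [x] it contains such a [y]; being upper, it
    contains the up-set of [y], a neighbourhood of [x]. *)

(** * Specialization order *)

Lemma spec_leP (X : topologicalType) (x y : X) :
  spec_le x y <-> forall U : set X, open U -> U x -> U y.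
Proof.
split=> [xy U oU Ux|xy B].
  by have [z [/= <-]] := xy U (open_nbhs_nbhs (conj oU Ux)).
rewrite nbhsE => -[U [oU Ux] UB].
exists y; split; [by []|exact: UB (xy U oU Ux)].
Qed.

Lemma spec_le_refl (X : topologicalType) (x : X) : spec_le x x.
Proof. by apply/spec_leP. Qed.

Lemma spec_le_trans (X : topologicalType) (y x z : X) :
  spec_le x y -> spec_le y z -> spec_le x z.
Proof.
move=> /spec_leP xy /spec_leP yz; apply/spec_leP => U oU /(xy _ oU).
exact: yz.
Qed.

(** T0 in the form needed to make specialization a partial order. *)
Lemma kolmogorovP (X : topologicalType) :
  kolmogorov_space X <->
  forall x y : X, spec_le x y -> spec_le y x -> x = y.
Proof.
split=> [T0 x y /spec_leP xy /spec_leP yx|anti x y /eqP xy].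
  apply/eqP/negPn/negP => /T0[A].
  rewrite !inE !nbhsE => -[] [[V [oV Vp] VA]] nA; apply/nA/VA.
    exact: xy.
  exact: yx.
suff [|] : ~ spec_le x y \/ ~ spec_le y x.
- move=> nxy; have [U /not_implyP[oU /not_implyP[Ux Uy]]] :
    exists U : set X, ~ (open U -> U x -> U y).
    by apply/existsNP => H; apply/nxy/spec_leP.
  by exists U; left; rewrite !inE; split=> //; exact: open_nbhs_nbhs.
- move=> nyx; have [U /not_implyP[oU /not_implyP[Uy Ux]]] :
    exists U : set X, ~ (open U -> U y -> U x).
    by apply/existsNP => H; apply/nyx/spec_leP.
  by exists U; right; rewrite !inE; split=> //; exact: open_nbhs_nbhs.
by apply/not_andP => -[*]; exact/xy/anti.
Qed.

(** * Comparing generating classes *)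

(** A test map into [X] from a space of [CC] can itself be tested by
    precomposing with maps from spaces of [CC'], so every [CC']-open set is
    [CC]-open. *)
Lemma class_generated_trans (CC CC' : space_class) (X : topologicalType) :
  (forall C, CC C -> class_generated CC' C) ->
  class_generated CC X -> class_generated CC' X.
Proof.
move=> CCgen genX U oU; apply: genX => C k CCk ck.
apply: (CCgen C CCk) => B h CC'B ch.
apply: (oU B (k \o h)) => // b.
by apply: continuous_comp; [exact: ch|exact: ck].
Qed.

Lemma class_generated_self (CC : space_class) (X : topologicalType) :
  CC X -> class_generated CC X.
Proof. by move=> CCX U /(_ X id); apply=> // x; exact. Qed.

(** * Strong one-point convergence spaces are algebraic *)

Section OnePointConv.
Variables (d : Order.disp_t) (D : porderType d).
Hypothesis dirD : directed_poset D.

(** A predicate form of the members of the subbase, for which membership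
    computes. *)
Definition basic_open (x : D) : set (one_point_conv D) :=
  fun p => if p is Some y then x <= y else True.

Lemma gamma_subbaseE : @gamma_subbase d D = range basic_open.
Proof.
suff E x : [set Some y | y in [set y : D | x <= y]] `|` [set None] =
           basic_open x.
  rewrite eqEsubset; split=> [B [x ->]|B [x _ <-]].
    by rewrite E; exists x.
  by exists x; rewrite E.
rewrite eqEsubset; split=> [p [[y xy <-]|->]|[y xy|_]] //; last by right.
by left; exists y.
Qed.

Lemma finI_gamma_subbase (B : set (one_point_conv D)) :
  finI_from (@gamma_subbase d D) id B ->
  [/\ forall x y : D, x <= y -> B (Some x) -> B (Some y),
      B None & exists x, B (Some x)].
Proof.
have [[x0] ubD] := dirD.
rewrite gamma_subbaseE => -[E /= Esub <-].
have {}Esub i : i \in enum_fset E -> exists a, i = basic_open a.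
  by move=> iE; have /[!inE] -[a _ <-] := Esub _ iE; exists a.
split.
- move=> x y xy Bx i iE; move: (Bx _ iE); have [a ->] := Esub _ iE => ax.
  exact: le_trans xy.
- by move=> i iE; have [a ->] := Esub _ iE.
(* An upper bound of the finitely many indices lies in the intersection; [x0]
   handles the empty intersection. *)
suff [x xE] : exists x : D, forall i, i \in enum_fset E -> i (Some x).
  by exists x => i iE; exact: xE.
elim: (enum_fset E) Esub => [_|i s IH Es]; first by exists x0.
have [x xs] : exists x : D, forall i, i \in s -> i (Some x).
  by apply: IH => j js; apply: Es; rewrite inE js orbT.
have [a ia] := Es i (mem_head _ _).
have [z [xz az]] := ubD x a.
exists z => j; rewrite inE => /predU1P[->|js]; first by rewrite ia.
have [b jb] : exists b, j = basic_open b by apply: Es; rewrite inE js orbT.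
by move: (xs j js); rewrite jb => bx; exact: le_trans xz.
Qed.

(** The working description of the topology.  Directedness is what makes the
    last condition survive finite intersections; conversely a set satisfying
    the three conditions is the union of the subbasic sets at its points
    of [D]. *)
Lemma open_one_point_conv (W : set (one_point_conv D)) :
  open W <->
  [/\ forall x y : D, x <= y -> W (Some x) -> W (Some y),
      forall x, W (Some x) -> W None &
      W None -> exists x, W (Some x)].
Proof.
split=> [[F FB <-]|[up WN Nx]].
  split.
  - move=> x y xy [B FB' Bx]; exists B => //.
    by have [up _ _] := finI_gamma_subbase (FB _ FB'); exact: up Bx.
  - move=> x [B FB' _]; exists B => //.
    by have [] := finI_gamma_subbase (FB _ FB').
  - move=> [B FB' _]; have [_ _ [x Bx]] := finI_gamma_subbase (FB _ FB').
    by exists x, B.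
exists [set B | exists2 x, W (Some x) & B = basic_open x].
  move=> B [x Wx ->]; apply: (@finI_from1 _ _ (@gamma_subbase d D) id).
  by rewrite gamma_subbaseE; exists x.
rewrite eqEsubset; split=> [[y|] [B [x Wx ->]] /= xp|[x|]].
- exact: up Wx.
- exact: WN Wx.
- by move=> Wx; exists (basic_open x); [exists x|exact: lexx].
- by move=> /Nx[x Wx]; exists (basic_open x); [exists x|].
Qed.

Lemma open_basic_open x : open (basic_open x).
Proof.
apply/open_one_point_conv; split=> //= [y z yz xy|_].
  exact: le_trans yz.
by exists x => /=.
Qed.

Lemma basic_open_up x : up_set (Some x : one_point_conv D) = basic_open x.
Proof.
rewrite eqEsubset; split=> p.
  by move=> /spec_leP; apply; [exact: open_basic_open|exact: lexx].
move=> xp; apply/spec_leP => U /open_one_point_conv[up UN _] Ux.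
by case: p xp => [y /= xy|_]; [exact: up Ux|exact: UN Ux].
Qed.

(** A largest element [m] of [D] would be indistinguishable from the added
    point; its absence is what separates the added point from [D] and gives
    T0. *)
Lemma AlgS_one_point_conv : ~ has_largest D -> AlgS (one_point_conv D).
Proof.
move=> nlD; split.
  have notNone x : ~ spec_le (None : one_point_conv D) (Some x).
    move=> /spec_leP xN; apply: nlD; exists x => y.
    exact: (xN _ (open_basic_open y)).
  have leE (x y : D) : spec_le (Some x : one_point_conv D) (Some y) -> x <= y.
    by move=> /spec_leP /(_ _ (open_basic_open x)); apply; exact: lexx.
  apply/kolmogorovP => -[x|] [y|] //.
  - by move=> /leE xy /leE yx; congr Some; apply/le_anti/andP.
  - by move=> _ /notNone.
  - by move=> /notNone.
move=> U p oU Up; have [up UN Nx] := (open_one_point_conv U).1 oU.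
have [x Ux xp] : exists2 x : D, U (Some x) & basic_open x p.
  by case: p Up => [x Ux|/Nx[x Ux]]; exists x => //=.
have intE : (up_set (Some x : one_point_conv D))° =
    up_set (Some x : one_point_conv D).
  by apply/interior_id; rewrite basic_open_up; exact: open_basic_open.
exists (Some x : one_point_conv D).
rewrite intE basic_open_up; split=> // -[y /= xy|_].
  exact: up Ux.
exact: UN Ux.
Qed.

End OnePointConv.

(** Open sets are transported along the homeomorphism by using it as a test map;
    this avoids transporting the algebraic property. *)
Lemma StrongOnePointConv_AlgS_generated (X : topologicalType) :
  StrongOnePointConv X -> class_generated AlgS X.
Proof.
move=> [d [D [dirD nlD [f [g [cf cg fK gK]]]]]] U oU.
have oUf := oU _ f (AlgS_one_point_conv dirD nlD) cf.
have /continuousP/(_ _ oUf) := cg.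
by rewrite -comp_preimage (_ : f \o g = id) ?preimage_id// funeqE.
Qed.

Lemma AlgS_ConS (X : topologicalType) : AlgS X -> ConS X.
Proof.
move=> [T0 algX]; split=> // U x oU Ux.
have [k [kx _ kU]] := algX U x oU Ux.
by exists k => //; apply: kU; exact: spec_le_refl.
Qed.

(** * Testing directed convergence *)

Section SpecializationPoset.
Variables (X : topologicalType) (T0 : kolmogorov_space X) (A : set X).

(** The T0 proof is an argument of the type so that the order structure, whose
    antisymmetry depends on it, can be attached to the type. *)
Definition spec_poset : Type := (fun=> set_type A) T0.

HB.instance Definition _ := Choice.on spec_poset.

Let le (a b : spec_poset) := `[< spec_le (val a) (val b) >].

Fact spec_poset_refl : reflexive le.
Proof. by move=> a; apply/asboolP; exact: spec_le_refl. Qed.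

Fact spec_poset_anti : antisymmetric le.
Proof.
move=> a b /andP[/asboolP ab /asboolP ba]; apply: val_inj.
exact: (kolmogorovP X).1.
Qed.

Fact spec_poset_trans : transitive le.
Proof.
move=> b a c /asboolP ab /asboolP bc; apply/asboolP.
exact: spec_le_trans bc.
Qed.

HB.instance Definition _ := Order.Le_isPOrder.Build (Order.Disp tt tt)
  spec_poset spec_poset_refl spec_poset_anti spec_poset_trans.

Lemma spec_poset_leE (a b : spec_poset) :
  a <= b <-> spec_le (val a) (val b).
Proof. by split=> /asboolP. Qed.

End SpecializationPoset.

(** [A] is directed for the specialization order and converges, as a net indexed
    by itself, to its upper bound [x]. *)
Definition directed_limit (X : topologicalType) (A : set X) (x : X) : Prop :=
  [/\ A !=set0,
      forall a b, A a -> A b -> exists c, [/\ A c, spec_le a c & spec_le b c],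
      forall a, A a -> spec_le a x &
      forall V : set X, open V -> V x -> exists2 a, A a & V a].

(** The test map goes from [one_point_conv (A * nat)] to [X], forgetting the
    natural number and sending the added point to [x].  The factor [nat]
    removes a possible largest element of [A] without affecting
    convergence. *)
Lemma directed_limit_StrongOnePointConv_open (X : topologicalType) (A : set X)
    (x : X) (U : set X) :
  kolmogorov_space X -> class_open StrongOnePointConv U ->
  directed_limit A x ->
  (forall a b, A a -> A b -> spec_le a b -> U a -> U b) /\
  (U x -> exists2 a, A a & U a).
Proof.
move=> T0 oU [[a0 Aa0] dirA Ax limA].
pose D : porderType _ := (spec_poset T0 A *p nat)%type.
pose pt (a : X) (Aa : A a) n : D := (SigSub (mem_set Aa) : spec_poset T0 A, n).
have leD (p q : D) : p <= q <-> spec_le (val p.1) (val q.1) /\ (p.2 <= q.2)%N.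
  case: p q => [a m] [b n]; rewrite le_pair; split.
    by move=> /andP[/spec_poset_leE].
  by move=> [ab mn]; apply/andP; split=> //; exact/spec_poset_leE.
have dirD : directed_poset D.
  split; first by constructor; exact: (pt a0 Aa0 0%N).
  move=> p q.
  have [c [Ac pc qc]] := dirA _ _ (set_valP p.1) (set_valP q.1).
  exists (pt c Ac (maxn p.2 q.2)).
  by split; apply/leD; split=> //=; rewrite ?leq_maxl ?leq_maxr.
have nlD : ~ has_largest D.
  move=> [[a n] /(_ (a, n.+1))/leD[_]] /=.
  by rewrite ltnn.
pose k (p : one_point_conv D) : X := if p is Some q then val q.1 else x.
have ck : continuous k.
  apply/continuousP => V oV; apply/(open_one_point_conv dirD); split=> /=.
  - by move=> p q /leD[/spec_leP pq _]; exact: pq.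
  - by move=> p; have /spec_leP := Ax _ (set_valP p.1); apply.
  - by move=> /(limA _ oV)[a Aa Va]; exists (pt a Aa 0%N).
have SD : StrongOnePointConv (one_point_conv D).
  by exists _, D; split=> //; exists id, id; split=> // p.
have /(open_one_point_conv dirD)[up _ Nx] := oU _ k SD ck.
split=> [a b Aa Ab ab Ua|/Nx[p Up]].
  by apply: (up (pt a Aa 0%N) (pt b Ab 0%N)) => //; exact/leD.
by exists (val p.1) => //; exact: set_valP.
Qed.

(** * Continuous spaces are generated by one-point convergence spaces *)

(** The pair [{x, y}], converging to its largest element [y], plays the role of
    the Sierpinski space as a test for being an upper set. *)
Lemma StrongOnePointConv_open_up (X : topologicalType) (U : set X) (x y : X) :
  kolmogorov_space X -> class_open StrongOnePointConv U ->
  spec_le x y -> U x -> U y.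
Proof.
move=> T0 oU xy.
suff lim : directed_limit [set x; y] y.
  have [up _] := directed_limit_StrongOnePointConv_open T0 oU lim.
  by apply: up => //=; [left|right].
have y_ub a : [set x; y] a -> spec_le a y.
  by move=> [->//|->]; exact: spec_le_refl.
split=> //.
- by exists x; left.
- by move=> a b /y_ub ay /y_ub yb; exists y; split=> //; right.
- by move=> V _ Vy; exists y => //; right.
Qed.

(** The points way below [x] form a directed set converging to [x], as in a
    continuous domain: directedness is the continuity axiom applied to the open
    neighbourhood [(up_set a)° `&` (up_set b)°] of [x]. *)
Lemma ConS_approximants (X : topologicalType) (x : X) :
  ConS X -> directed_limit [set y | (up_set y)° x] x.
Proof.
move=> [_ conX]; split.
- by have [y _ yx] := conX setT x openT I; exists y.
- move=> a b ax bx.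
  have [c [ac bc] cx] := conX _ x (openI (open_interior (up_set a))
    (open_interior (up_set b))) (conj ax bx).
  by exists c; split=> //; exact: interior_subset.
- by move=> a; exact: interior_subset.
- by move=> V oV Vx; have [y Vy yx] := conX V x oV Vx; exists y.
Qed.

Lemma ConS_StrongOnePointConv_generated (X : topologicalType) :
  ConS X -> class_generated StrongOnePointConv X.
Proof.
move=> conX U oU; have [T0 _] := conX.
rewrite openE => x Ux.
have [_ /(_ Ux)[y yx Uy]] :=
  directed_limit_StrongOnePointConv_open T0 oU (ConS_approximants x conX).
apply: interiorS yx => z yz.
exact: StrongOnePointConv_open_up Uy.
Qed.

(** * The three categories coincide *)

Theorem theorem38 :
  Top_gen AlgS = Top_gen ConS /\ Top_gen ConS = Top_gen StrongOnePointConv.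
Proof.
have AC X : class_generated AlgS X -> class_generated ConS X.
  apply: class_generated_trans => C /AlgS_ConS; exact: class_generated_self.
have CS X : class_generated ConS X -> class_generated StrongOnePointConv X.
  apply: class_generated_trans; exact: ConS_StrongOnePointConv_generated.
have SA X : class_generated StrongOnePointConv X -> class_generated AlgS X.
  apply: class_generated_trans; exact: StrongOnePointConv_AlgS_generated.
by split; apply/funext => X; apply/propext; split=> -[T0 gX]; split=> //; auto.
Qed.
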